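(* Let $R$ be a ring and $M$ an $R$-module. The ring extension $R\subseteq R(+)M$ has FIP if and only if $M$ has only finitely many $R$-submodules. In this case, $|[R,R(+)M]|=\nu(M)$, where $\nu(M)$ is the number of $R$-submodules of $M$.
   Context: All rings are commutative, unital and nonzero. $R(+)M$ is the idealization of $M$: the set $R\times M$ with operations $(r,m)+(s,n)=(r+s,m+n)$ and $(r,m)(s,n)=(rs,rn+sm)$; $R$ is identified with a subring via $r\mapsto(r,0)$. For a ring extension $R\subseteq S$, $[R,S]$ is the set of all $R$-subalgebras of $S$; the extension has FIP if $[R,S]$ is finite. *)

(* Defs.v *)
From HB Require Import structures.
From mathcomp Require Import all_boot all_order all_algebra.
From mathcomp Require Import finmap.
From mathcomp Require Import boolp classical_sets cardinality.

Set Implicit Arguments.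
Unset Strict Implicit.
Unset Printing Implicit Defensive.

Import GRing.Theory.

Local Open Scope classical_set_scope.
Local Open Scope ring_scope.

(* R(+)M. An alias of the module product R^o * M: the type R * M itself must
   keep the componentwise multiplication of the library. *)
Definition idealization (R : comNzRingType) (M : lmodType R) : Type :=
  (R^o * M)%type.

Section Idealization.
Variables (R : comNzRingType) (M : lmodType R).

Local Notation RM := (idealization M).

HB.instance Definition _ := GRing.Lmodule.copy RM (R^o * M)%type.

Definition idealization_one : RM := (1, 0).

Definition idealization_mul (x y : RM) : RM :=
  (x.1 * y.1, x.1 *: y.2 + y.1 *: x.2).

Fact idealization_mulA : associative idealization_mul.
Proof.
move=> [r m] [s n] [t p]; congr pair; rewrite /= ?mulrA //.
by rewrite !scalerDr !scalerA addrA [t * r]mulrC [t * s]mulrC mulrC [s * t]mulrC.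
Qed.

Fact idealization_mulC : commutative idealization_mul.
Proof. by move=> [r m] [s n]; congr pair; rewrite /= 1?mulrC 1?addrC. Qed.

Fact idealization_mul1 : left_id idealization_one idealization_mul.
Proof. by move=> [r m]; congr pair; rewrite /= ?mul1r // scale1r scaler0 addr0. Qed.

Fact idealization_mulDl : left_distributive idealization_mul +%R.
Proof.
move=> [r m] [s n] [t p]; congr pair; rewrite /= ?mulrDl //.
by rewrite scalerDl scalerDr addrACA.
Qed.

Fact idealization_one_neq0 : idealization_one != 0.
Proof. by apply/eqP => -[/eqP]; rewrite oner_eq0. Qed.

HB.instance Definition _ := GRing.Zmodule_isComNzRing.Build RM
  idealization_mulA idealization_mulC idealization_mul1 idealization_mulDl
  idealization_one_neq0.

Fact idealization_scaleAl (a : R) (x y : RM) : a *: (x * y) = (a *: x) * y.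
Proof.
case: x y => [r m] [s n]; congr pair; first exact: mulrA.
by rewrite /= scalerDr !scalerA [s * a]mulrC.
Qed.

HB.instance Definition _ :=
  GRing.Lmodule_isLalgebra.Build R RM idealization_scaleAl.
HB.instance Definition _ := GRing.Lalgebra_isComAlgebra.Build R RM.

(* The structure map r |-> r%:A of this algebra is the embedding r |-> (r, 0). *)
Lemma idealization_inE (r : R) : r%:A = (r, 0) :> RM.
Proof. by congr pair; [exact: mulr1 | exact: scaler0]. Qed.

Lemma idealization_in_inj : injective (fun r : R => r%:A : RM).
Proof. by move=> r s; rewrite !idealization_inE => -[]. Qed.

End Idealization.

(* [R, S]; the inclusion R -> S is the structure map r |-> r%:A, and every
   member contains its image, being closed under scaling and containing 1. *)
Definition subalgebras (R : comNzRingType) (S : comAlgType R) : set (set S) :=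
  [set A : set S | GRing.subalg_closed (mem A)].
Arguments subalgebras {R} S.

Definition has_FIP (R : comNzRingType) (S : comAlgType R) : Prop :=
  finite_set (subalgebras S).

Definition submodules (R : comNzRingType) (M : lmodType R) : set (set M) :=
  [set N : set M | GRing.submod_closed (mem N)].
Arguments submodules {R} M.

(* fset_set sends an infinite set to fset0: the two cardinals below are
   meaningful only under a finiteness hypothesis. *)
Definition nb_subalgebras (R : comNzRingType) (S : comAlgType R) : nat :=
  #|` fset_set (subalgebras S)|.

Definition nu (R : comNzRingType) (M : lmodType R) : nat :=
  #|` fset_set (submodules M)|.

(* Main.v *)
Require Import Defs.
From mathcomp Require Import all_boot all_algebra.
From mathcomp Require Import finmap.
From mathcomp Require Import classical_sets cardinality.

(** A subalgebra [A] of [R(+)M] contains every [(r, 0)], so [(r, m)] lies in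
    [A] exactly when [(0, m) = (r, m) - (r, 0)] does: [A] is determined by its
    trace [N] on the ideal [0 (+) M], and [A = R (+) N].  As
    [r *: (0, m) = (0, r *: m)], this trace is a submodule.  Conversely
    [R (+) N] is a subalgebra for every submodule [N], since the second
    component of [(r, m) (s, n)] is the linear combination [r *: n + s *: m].
    So [N |-> R (+) N] ([ideal_extension]) and [A |-> N] ([ideal_trace]) are
    mutually inverse bijections between the submodules of [M] and the
    subalgebras of [R(+)M], which gives both the transfer of finiteness and the
    equality of the two numbers. *)

Import GRing.Theory.
Local Open Scope classical_set_scope.
Local Open Scope ring_scope.

Section Correspondence.
Variables (R : comNzRingType) (M : lmodType R).
Local Notation RM := (idealization M).

Definition ideal_extension (N : set M) : set RM := [set x | N x.2].

Definition ideal_trace (A : set RM) : set M := [set m | A (0, m)].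

Lemma ideal_extensionK : cancel ideal_extension ideal_trace.
Proof. by []. Qed.

Lemma ideal_extension_subalgebra (N : set M) :
  submodules M N -> subalgebras RM (ideal_extension N).
Proof.
case=> N0 Nlin.
have ND a u v : N u -> N v -> N (a *: u + v).
  by move=> Nu Nv; apply/set_mem/Nlin; apply/mem_set.
move/set_mem: N0 => N0.
split; first exact/mem_set.
- by move=> a u v /set_mem Nu /set_mem Nv; apply/mem_set/ND.
move=> u v /set_mem Nu /set_mem Nv; apply/mem_set/ND => //.
by rewrite -[X in N X]addr0; apply: ND.
Qed.

Lemma ideal_trace_submodule (A : set RM) :
  subalgebras RM A -> submodules M (ideal_trace A).
Proof.
case=> A1 Alin _; split.
  (* [0 = (-1) *: 1 + 1]: closure under linear combinations needs a first
     element, and the unit is the one at hand. *)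
  have := Alin (-1) _ _ A1 A1; rewrite scaleN1r addNr => /set_mem A0.
  exact/mem_set.
move=> a m n /set_mem Am /set_mem An; apply/mem_set.
have /set_mem := Alin a _ _ (mem_set Am) (mem_set An).
have -> // : a *: ((0, m) : RM) + (0, n) = (0, a *: m + n).
by congr pair; rewrite /= scaler0 addr0.
Qed.

(** The two implications add, respectively subtract, the scalar
    [r%:A = (r, 0)] of [A]. *)
Lemma subalgebra_trace (A : set RM) (r : R) (m : M) :
  subalgebras RM A -> A (0, m) <-> A (r, m).
Proof.
case=> A1 Alin _; split=> Am.
  have /set_mem := Alin r _ _ A1 (mem_set Am).
  have -> // : (r%:A : RM) + (0, m) = (r, m).
  by rewrite idealization_inE; congr pair; rewrite /= ?addr0 ?add0r.
have /set_mem := Alin (- r) _ _ A1 (mem_set Am).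
have -> // : ((- r)%:A : RM) + (r, m) = (0, m).
by rewrite idealization_inE; congr pair; rewrite /= ?addNr ?add0r.
Qed.

Lemma ideal_traceK (A : set RM) :
  subalgebras RM A -> ideal_extension (ideal_trace A) = A.
Proof.
by move=> subA; apply/seteqP; split=> -[r m] /(subalgebra_trace A r m subA).
Qed.

Lemma subalgebras_idealization :
  subalgebras RM = ideal_extension @` submodules M.
Proof.
apply/seteqP; split=> [A subA | _ [N subN <-]].
  exists (ideal_trace A); first exact: ideal_trace_submodule.
  exact: ideal_traceK.
exact: ideal_extension_subalgebra.
Qed.

Lemma submodules_idealization : submodules M = ideal_trace @` subalgebras RM.
Proof.
rewrite subalgebras_idealization image_comp.
by rewrite (_ : ideal_trace \o ideal_extension = id) ?image_id.
Qed.

End Correspondence.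

Theorem proposition5p4 (R : comNzRingType) (M : lmodType R) :
  (has_FIP (idealization M) <-> finite_set (submodules M)) /\
  (has_FIP (idealization M) ->
     nb_subalgebras (idealization M) = nu M).
Proof.
have FIP_fin : has_FIP (idealization M) <-> finite_set (submodules M).
  split=> fin.
    by rewrite submodules_idealization; apply: finite_image.
  by rewrite /has_FIP subalgebras_idealization; apply: finite_image.
split=> // /FIP_fin fin.
rewrite /nb_subalgebras /nu subalgebras_idealization fset_set_image //.
by rewrite card_imfset //; apply: can_inj (ideal_extensionK _ _).
Qed.
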